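(* Let $n$ and $m$ be integers with $n\geq 2$ and $n<m\leq 2n$. If $m$ is a prime, then $$\psi_n(m)=\sqrt{m+\sqrt{2(m-1)}};$$ otherwise $\psi_n(m)=\sqrt{m}$.
   Context: The trace norm $\|A\|_*$ of a matrix $A$ is the sum of its singular values. For integers $n\geq 2$ and $1\leq m\leq n^2$, $\mathbb{Z}_n(m)$ denotes the set of $(0,1)$-matrices of size $n\times n$ with exactly $m$ entries equal to $1$, and $\psi_n(m)=\min\{\|A\|_* : A\in\mathbb{Z}_n(m)\}$. *)

(* Defs.v *)
From mathcomp Require Import all_boot all_order all_algebra.
From mathcomp Require Import polyrcf.

Set Implicit Arguments.
Unset Strict Implicit.
Unset Printing Implicit Defensive.

Import Order.TTheory GRing.Theory Num.Theory.
Local Open Scope ring_scope.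

(* The real numbers are an arbitrary real closed field R: eigenvalues of real
   symmetric matrices and square roots of nonnegative elements exist there. *)

(* Square roots of the eigenvalues of A^T A, each repeated according to its
   algebraic multiplicity.  All eigenvalues of A^T A lie in R, so that
   rootsR misses none of them; it lists each one once. *)
Definition singular_values (R : rcfType) (n : nat) (A : 'M[R]_n) : seq R :=
  let p := char_poly (A^T *m A) in
  flatten [seq nseq (mup x p) (Num.sqrt x) | x <- rootsR p].

Definition trace_norm (R : rcfType) (n : nat) (A : 'M[R]_n) : R :=
  \sum_(s <- singular_values A) s.

(* (0,1)-matrices are encoded as boolean matrices, which form a finite type. *)
Definition mx01 (R : rcfType) (n : nat) (A : 'M[bool]_n) : 'M[R]_n :=
  \matrix_(i, j) (A i j)%:R.

Definition Z01 (n m : nat) : {set 'M[bool]_n} :=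
  [set A : 'M[bool]_n | #|[set ij : 'I_n * 'I_n | A ij.1 ij.2]| == m].

(* The all-ones matrix is only a default value, returned when Z01 n m is empty,
   i.e. when n ^ 2 < m; see psi_attained and psi_le. *)
Definition psi (R : rcfType) (n m : nat) : R :=
  trace_norm (mx01 R
    [arg min_(A < const_mx true in Z01 n m) trace_norm (mx01 R A)]%O).

Lemma Z01_neq0 (n m : nat) : (m <= n ^ 2)%N -> Z01 n m != set0.
Proof.
move=> le_mn2.
have /card_geqP [s [us ss _]] : (m <= #|[set: 'I_n * 'I_n]|)%N.
  by rewrite cardsT card_prod card_ord mulnn.
apply/set0Pn; exists (\matrix_(i, j) ((i, j) \in s)).
rewrite inE -ss -(card_uniqP us) -cardsE; apply/eqP/eq_card => -[i j].
by rewrite !inE mxE.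
Qed.

Lemma psi_arg_minP (R : rcfType) (n m : nat) : (m <= n ^ 2)%N ->
  exists2 A, A \in Z01 n m &
    psi R n m = trace_norm (mx01 R A) /\
    forall B, B \in Z01 n m -> trace_norm (mx01 R A) <= trace_norm (mx01 R B).
Proof.
move=> /Z01_neq0/set0Pn[A0 ZA0]; rewrite /psi /Order.arg_min /extremum.
case: pickP => [A /andP[ZA /forallP minA] | noA] /=.
  by exists A => //; split=> // B ZB; apply: (implyP (minA B)).
case: (@Order.TotalTheory.arg_minP _ _ _ A0 (mem (Z01 n m))
         (fun A => trace_norm (mx01 R A)) ZA0) => A ZA minA.
have /negP[] := negbT (noA A); apply/andP; split=> //.
by apply/forallP => B; apply/implyP; apply: minA.
Qed.

Lemma psi_attained (R : rcfType) (n m : nat) : (m <= n ^ 2)%N ->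
  exists2 A, A \in Z01 n m & psi R n m = trace_norm (mx01 R A).
Proof. by move=> /(psi_arg_minP R)[A ZA [-> _]]; exists A. Qed.

Lemma psi_le (R : rcfType) (n m : nat) (A : 'M[bool]_n) :
  A \in Z01 n m -> psi R n m <= trace_norm (mx01 R A).
Proof.
move=> ZA; have le_mn2 : (m <= n ^ 2)%N.
  move: (ZA); rewrite inE => /eqP <-.
  by rewrite (leq_trans (max_card _)) // card_prod card_ord mulnn.
by have [B _ [-> ->]] := psi_arg_minP R le_mn2.
Qed.

(* Main.v *)
Require Import Defs.
From mathcomp Require Import all_boot all_order all_algebra.
From mathcomp Require Import polyrcf complex spectral ring lra zify.

Set Implicit Arguments.
Unset Strict Implicit.
Unset Printing Implicit Defensive.

Import Order.TTheory GRing.Theory Num.Theory.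
Local Open Scope ring_scope.
Local Open Scope sesquilinear_scope.

(** Write s_1, ..., s_n for the singular values of A and G = A^T A, so that the
    sum of the s_i ^ 2 is tr G and the sum of the s_i ^ 4 is tr (G ^ 2).  Then
    (\sum s_i)^2 = tr G + T, where T is the sum of the s_i s_j over ordered
    pairs i != j, and since the s_i are nonnegative, expanding T^2 gives
      T^2 >= 2 ((tr G)^2 - tr (G^2)),
    with equality when at most two of the s_i are nonzero ([sum_power_bounds],
    [sum_power_two]).  For a (0,1)-matrix A with m ones, tr G = m, while
    tr (G^2) is the number of ordered pairs ((i,j), (k,l)) of ones such that
    (i,l) and (k,j) are ones as well.  Hence (tr G)^2 - tr (G^2) is the number
    b of clashing ordered pairs of ones, those spanning a 2 x 2 submatrix that
    contains a zero ([trace_sqr_gram_mx01]), and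
      |A|_* >= sqrt (m + sqrt (2 b)),
    with equality when A has rank at most 2 ([trace_norm_ge],
    [trace_norm_eq]).

    It remains to minimize b.  A composite m = a b' with m <= 2n has
    a, b' <= n, and an all-ones block of size a x b' has no clash.  If m is a
    prime larger than n, then no such block fits, so some zero lies in a
    nonzero row and a nonzero column; this forces b >= m - 1
    ([sum_clashing_ge]).  The bound is attained by a block of size
    (m + 1) / 2 x 2 with one corner removed ([trace_norm_two_columns]). *)

(** * The spectrum of a Gram matrix *)

(** The nonzero entries are the diagonal of an invertible diagonal submatrix. *)
Lemma card_diag_mx_le (F : fieldType) (n : nat) (d : 'rV[F]_n) :
  (#|[set i : 'I_n | d ord0 i != 0%R]| <= \rank (diag_mx d))%N.
Proof.
set S := [set i | _]; pose f := @enum_val _ (mem S).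
have defD : mxsub f f (diag_mx d) = rowsub f 1%:M *m diag_mx d *m colsub f 1%:M.
  by rewrite mulmx_colsub mulmx1 -rowsubE; apply/matrixP => i j; rewrite !mxE.
have uD : mxsub f f (diag_mx d) \in unitmx.
  have -> : mxsub f f (diag_mx d) = diag_mx (\row_i d ord0 (f i)).
    apply/matrixP => i j; rewrite !mxE.
    by rewrite (inj_eq enum_val_inj).
  rewrite unitmxE det_diag unitfE; apply/prodf_neq0 => i _.
  by rewrite mxE; have := enum_valP i; rewrite inE.
rewrite -(mxrank_unit uD) defD.
by rewrite (leq_trans (mxrankM_maxl _ _)) // mxrankM_maxr.
Qed.

Lemma char_poly_conj (F : fieldType) (n : nat) (P D : 'M[F]_n) :
  P \in unitmx -> char_poly (invmx P *m D *m P) = char_poly D.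
Proof.
move=> uP; pose P' := map_mx polyC P.
have uP' : P' \in unitmx.
  by rewrite unitmxE det_map_mx rmorph_unit // -unitmxE.
have PchD : P' *m char_poly_mx (invmx P *m D *m P) = char_poly_mx D *m P'.
  rewrite /char_poly_mx mulmxBr mulmxBl scalar_mxC; congr (_ - _).
  by rewrite -!map_mxM /= !mulmxA mulmxV // mul1mx.
rewrite unitmxE in uP'.
by apply: (mulrI uP'); rewrite /char_poly -det_mulmx PchD det_mulmx mulrC.
Qed.

(** Over R[i] the Gram matrix is hermitian, hence unitarily diagonalizable, and
    its diagonal form is itself the Gram matrix of A P^-1; its diagonal entries
    are therefore sums of squared moduli, so they are real and nonnegative. *)
Lemma gram_spectrum (R : rcfType) (n : nat) (A : 'M[R]_n) (G := A^T *m A) :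
  exists d : 'I_n -> R,
    [/\ forall i, 0 <= d i, char_poly G = \prod_i ('X - (d i)%:P),
        \sum_i d i = \tr G, \sum_i d i ^+ 2 = \tr (G *m G)
      & (#|[set i | d i != 0%R]| <= \rank A)%N].
Proof.
pose toC := real_complex R; pose AC := map_mx toC A; pose GC := map_mx toC G.
have defGC : GC = AC^T *m AC by rewrite /GC map_mxM map_trmx.
have conjAC : map_mx Num.conj AC = AC.
  by apply/matrixP => i j; rewrite !mxE; apply/CrealP/complex_realP;
    exists (A i j).
have trAC : AC ^t* = AC^T by rewrite -map_trmx conjAC.
have trGC : GC ^t* = GC.
  rewrite defGC trmx_mul trmxK map_mxM /=.
  by rewrite trAC conjAC.
have nGC : GC \is normalmx by apply/normalmxP; rewrite trGC.
have GCE := orthomx_spectralP nGC.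
have /= uP := spectral_unitarymx GC; have /= invP := spectral_unit GC.
set P := spectralmx GC in GCE uP invP; set d := spectral_diag GC in GCE.
have defD : diag_mx d = (AC *m invmx P) ^t* *m (AC *m invmx P).
  have -> : diag_mx d = P *m GC *m invmx P.
    by rewrite GCE !mulmxA mulmxV // mul1mx mulmxK.
  rewrite invmx_unitary // trmx_mul map_mxM -map_trmx trmxK.
  by rewrite -map_mx_comp (map_mx_id (@conjCK _)) trAC defGC !mulmxA.
have d_ge0 i : 0 <= d 0 i.
  have /matrixP /(_ i i) := defD; rewrite !mxE eqxx mulr1n => ->.
  by apply: sumr_ge0 => j _; rewrite !mxE mulrC mul_conjC_ge0.
have dE i : toC (complex.Re (d 0 i)) = d 0 i by apply/RRe_real/ger0_real.
have trE : \tr GC = \sum_i d 0 i.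
  by rewrite GCE -mulmxA mxtrace_mulC mulmxK // mxtrace_diag.
have trE2 : \tr (GC *m GC) = \sum_i d 0 i ^+ 2.
  rewrite GCE !mulmxA mulmxK // -!mulmxA mxtrace_mulC !mulmxA.
  rewrite mulmxK // mulmx_diag mxtrace_diag.
  by apply: eq_bigr => i _; rewrite mxE.
exists (fun i => complex.Re (d 0 i)); split.
- by move=> i; rewrite -ler0c [_%:C%C]dE.
- apply: (map_poly_inj toC); rewrite map_char_poly -/GC GCE char_poly_conj //.
  rewrite char_poly_trig ?diag_mx_is_trig // rmorph_prod.
  apply: eq_bigr => i _.
  by rewrite /= map_polyXsubC /= [X in _ = 'X - X%:P]dE mxE eqxx.
- apply: complexI; rewrite -[RHS](trace_map_mx toC) -/GC trE.
  by rewrite (rmorph_sum toC); apply: eq_bigr => i _; apply: dE.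
- apply: complexI; rewrite -[RHS](trace_map_mx toC) map_mxM -/GC trE2.
  rewrite (rmorph_sum toC); apply: eq_bigr => i _.
  by rewrite (rmorphXn toC); congr (_ ^+ 2); apply: dE.
- rewrite -(mxrank_map toC) -/AC.
  apply: leq_trans (_ : (\rank (diag_mx d) <= _)%N).
    apply: leq_trans (card_diag_mx_le d).
    apply: subset_leq_card; apply/subsetP => i; rewrite !inE.
    by apply: contra_neq => ->.
  by rewrite defD (leq_trans (mxrankM_maxr _ _)) // mxrankM_maxl.
Qed.

(** * Singular values and their power sums *)

Lemma perm_rootsR_mup (R : rcfType) (s : seq R)
    (p := \prod_(x <- s) ('X - x%:P)) :
  perm_eq (flatten [seq nseq (mup x p) x | x <- rootsR p]) s.
Proof.
have p_neq0 : p != 0 by rewrite monic_neq0 ?monic_prod_XsubC.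
have rootsE : perm_eq (rootsR p) (undup s).
  apply: uniq_perm; rewrite ?undup_uniq //.
    exact: (sorted_uniq lt_trans (@ltxx _ _) (sorted_roots _ _ _)).
  move=> x; rewrite -(roots_on_rootsR p_neq0) in_itv /=.
  by rewrite mem_undup -root_prod_XsubC.
apply: perm_trans (perm_count_undup s).
rewrite (eq_map (fun x => congr1 (fun k => nseq k x) (mu_prod_XsubC x s))).
exact: perm_flatten (perm_map _ rootsE).
Qed.

(** All that is used about singular values: their second and fourth power sums
    are traces, and the rank bounds the number of nonzero ones. *)
Lemma singular_valuesP (R : rcfType) (n : nat) (A : 'M[R]_n)
    (s := singular_values A) (G := A^T *m A) :
  [/\ all (>= 0)%R s, \sum_(x <- s) x ^+ 2 = \tr G,
      \sum_(x <- s) x ^+ 4 = \tr (G *m G)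
    & (count (fun x => x != 0%R) s <= \rank A)%N].
Proof.
have [d [d_ge0 chE sum1 sum2 rkA]] := gram_spectrum A.
have sE : perm_eq s [seq Num.sqrt (d i) | i <- index_enum 'I_n].
  have -> : s = [seq Num.sqrt x | x <- flatten
      [seq nseq (mup x (char_poly G)) x | x <- rootsR (char_poly G)]].
    rewrite map_flatten -map_comp; congr flatten.
    by apply: eq_map => x; rewrite /= map_nseq.
  rewrite [X in perm_eq _ X]map_comp; apply: perm_map.
  by rewrite chE -(big_map d predT (fun x => 'X - x%:P)) perm_rootsR_mup.
split.
- by rewrite (perm_all _ sE); apply/allP => _ /mapP[i _ ->]; apply: sqrtr_ge0.
- rewrite (perm_big _ sE) big_map -sum1.
  by apply: eq_bigr => i _; rewrite sqr_sqrtr.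
- rewrite (perm_big _ sE) big_map -sum2.
  by apply: eq_bigr => i _; rewrite (exprM _ 2 2) sqr_sqrtr.
- rewrite (permP sE) count_map; apply: leq_trans rkA.
  apply: eq_leq; rewrite -sum1_card -sum1_count.
  apply: eq_bigl => i.
  by rewrite /= inE sqrtr_eq0 -ltNge lt_neqAle d_ge0 andbT eq_sym.
Qed.

(** Induction on s.  With S1, S2, S4 the power sums of s and T = S1^2 - S2,
    adding an entry a replaces T by T + 2 a S1, and increases
    T^2 - 2 (S2^2 - S4) by 4 a S1 T + 4 a^2 T, which is nonnegative because
    S1^2 - S2 = T >= 0 is part of the induction hypothesis. *)
Lemma sum_power_bounds (R : realDomainType) (s : seq R) : all (>= 0)%R s ->
  [/\ 0 <= \sum_(x <- s) x, \sum_(x <- s) x ^+ 2 <= (\sum_(x <- s) x) ^+ 2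
    & 2 * ((\sum_(x <- s) x ^+ 2) ^+ 2 - \sum_(x <- s) x ^+ 4)
      <= ((\sum_(x <- s) x) ^+ 2 - \sum_(x <- s) x ^+ 2) ^+ 2].
Proof.
elim: s => [|a s IHs] /=; first by rewrite !big_nil; split; lra.
case/andP => a_ge0 /IHs[]; rewrite !big_cons.
set S1 := \sum_(x <- s) x; set S2 := \sum_(x <- s) x ^+ 2.
set S4 := \sum_(x <- s) x ^+ 4 => S1_ge0 S2_le S4_le.
have aS1_ge0 : 0 <= a * S1 by apply: mulr_ge0.
have T_ge0 : 0 <= S1 ^+ 2 - S2 by lra.
have aT_ge0 := mulr_ge0 aS1_ge0 T_ge0.
have a2T_ge0 := mulr_ge0 (sqr_ge0 a) T_ge0.
split; [lra | lra |].
rewrite -subr_ge0.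
rewrite (_ : _ - _ = ((S1 ^+ 2 - S2) ^+ 2 - 2 * (S2 ^+ 2 - S4)) +
  4 * (a * S1 * (S1 ^+ 2 - S2)) + 4 * (a ^+ 2 * (S1 ^+ 2 - S2))); last by ring.
lra.
Qed.

(** For two entries a and b both sides are 4 a^2 b^2. *)
Lemma sum_power_two (R : comRingType) (s : seq R) :
  (count (fun x => x != 0%R) s <= 2)%N ->
  ((\sum_(x <- s) x) ^+ 2 - \sum_(x <- s) x ^+ 2) ^+ 2 =
  2 * ((\sum_(x <- s) x ^+ 2) ^+ 2 - \sum_(x <- s) x ^+ 4).
Proof.
have drop0 k : \sum_(x <- s) x ^+ k.+1 =
    \sum_(x <- [seq x <- s | x != 0]) x ^+ k.+1.
  rewrite big_filter [LHS](bigID (fun x => x != 0)) /=.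
  rewrite [X in _ + X]big1 ?addr0 //.
  by move=> x; rewrite negbK => /eqP ->; rewrite expr0n.
rewrite -size_filter (drop0 0) (drop0 1) (drop0 3).
case: [seq x <- s | _] => [|a [|b [|//]]] _; rewrite !(big_cons, big_nil); ring.
Qed.

(** * Clashing pairs of ones *)

Definition ones (n : nat) (A : 'M[bool]_n) : {set 'I_n * 'I_n} :=
  [set u | A u.1 u.2].

(** The ones v that span with u a 2 x 2 submatrix containing a zero. *)
Definition clashing (n : nat) (A : 'M[bool]_n) (u : 'I_n * 'I_n) :
  {set 'I_n * 'I_n} := [set v in ones A | ~~ (A u.1 v.2 && A v.1 u.2)].

Lemma trace_gram_mx01 (R : rcfType) (n : nat) (A : 'M[bool]_n) :
  \tr ((mx01 R A)^T *m mx01 R A) = #|ones A|%:R.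
Proof.
have -> : #|ones A|%:R = \sum_u (A u.1 u.2)%:R :> R.
  by rewrite -sum1dep_card natr_sum big_mkcond; apply: eq_bigr => u _;
    case: ifP.
rewrite -(pair_bigA _ (fun i j => (A i j)%:R)) exchange_big.
apply: eq_bigr => j _; rewrite mxE; apply: eq_bigr => i _.
by rewrite !mxE -natrM mulnb andbb.
Qed.

(** The trace of G^2 counts closed walks i, j, k, l in the bipartite graph of A,
    that is, the ordered pairs of ones (i, j), (k, l) that do not clash. *)
Lemma trace_sqr_gram_mx01 (R : rcfType) (n : nat) (A : 'M[bool]_n)
    (G := (mx01 R A)^T *m mx01 R A) :
  \tr (G *m G) = #|ones A|%:R ^+ 2 - (\sum_(u in ones A) #|clashing A u|)%:R.
Proof.
pose fits u v := [&& A u.1 u.2, A v.1 v.2, A u.1 v.2 & A v.1 u.2].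
have trE : \tr (G *m G) = \sum_u \sum_v (fits u v)%:R.
  rewrite -(pair_bigA _ (fun i j => \sum_v (fits (i, j) v)%:R)) exchange_big.
  apply: eq_bigr => j _; rewrite mxE.
  under [RHS]eq_bigr => i _ do
    rewrite -(pair_bigA _ (fun k l => (fits (i, j) (k, l))%:R)) exchange_big /=.
  rewrite [RHS]exchange_big; apply: eq_bigr => l _.
  rewrite !mxE big_distrl; apply: eq_bigr => i _.
  rewrite big_distrr; apply: eq_bigr => k _.
  rewrite !mxE -!natrM !mulnb /fits /= -natrM mulnb.
  by case: (A i j) (A i l) (A k l) (A k j) => [] [] [] [].
have -> : #|ones A|%:R ^+ 2 = \sum_(u in ones A) #|ones A|%:R :> R.
  by rewrite sumr_const -natrX -mulrnA mulnn.
rewrite natr_sum -sumrB trE [RHS]big_mkcond; apply: eq_bigr => u _.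
rewrite inE; case Au: (A u.1 u.2); last first.
  by rewrite big1 // => v _; rewrite /fits Au.
apply/eqP; rewrite eq_sym subr_eq -[\sum_v _]natr_sum -natrD; apply/eqP.
congr (1 *+ _); rewrite -sum1_card -[#|clashing _ _|]sum1_card.
rewrite [X in _ = (_ + X)%N]big_mkcond [X in X = _]big_mkcond -big_split.
apply: eq_bigr => v _; rewrite /fits !inE Au /=.
by case: (A v.1 v.2); case: (A u.1 v.2 && A v.1 u.2).
Qed.

(** Call a row full if it has a one in every nonzero column, and similarly for
    columns; let F and C be the sets of full rows and full columns, of sizes r
    and c.  A one without clash lies in F x C: the other ones each have at
    least one clash.  The zero (k0, j0) provides further clashes: every one
    (i, j0) in a full row clashes with every one (k0, l) in a full column.  So
    the r ones of F x {j0} have at least c clashes each, the c ones of {k0} x C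
    have at least r each, and with w other ones outside F x C there are
    m = r c + r + c + w ones and at least 2 r c + w clashes.  When r and c are
    positive this is at least m - 1 since (r - 1)(c - 1) >= 0; when one of them
    is 0, every one has a clash. *)
Lemma sum_clashing_ge (n : nat) (A : 'M[bool]_n) (k0 j0 l1 i1 : 'I_n) :
    ~~ A k0 j0 -> A k0 l1 -> A i1 j0 ->
  (#|ones A|.-1 <= \sum_(u in ones A) #|clashing A u|)%N.
Proof.
move=> A0 Arow Acol.
pose F := [set i | [forall j, [exists i', A i' j] ==> A i j]].
pose C := [set j | [forall i, [exists j', A i j'] ==> A i j]].
have FP i j i' : i \in F -> A i' j -> A i j.
  rewrite inE => /forallP/(_ j)/implyP Aij Ai'j.
  by apply: Aij; apply/existsP; exists i'.
have CP i j j' : j \in C -> A i j' -> A i j.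
  rewrite inE => /forallP/(_ i)/implyP Aij Aij'.
  by apply: Aij; apply/existsP; exists j'.
have inXE (B D : {set 'I_n}) u : (u \in setX B D) = (u.1 \in B) && (u.2 \in D).
  by case: u => i j; rewrite in_setX.
have inX (B D : {set 'I_n}) u :
    reflect (u.1 \in B /\ u.2 \in D) (u \in setX B D).
  by rewrite inXE; apply: andP.
pose I := setX F C; pose U := setX F [set j0]; pose V := setX [set k0] C.
(* A one u with no clash sees all nonzero columns in its row and all nonzero
   rows in its column. *)
have W_ge u : u \in ones A -> u \notin I -> (1 <= #|clashing A u|)%N.
  move=> Au; rewrite lt0n; apply: contraNneq => /eqP.
  rewrite cards_eq0 => /eqP/setP u0; apply/inX; split; rewrite inE.
    apply/forallP=> j; apply/implyP => /existsP[i Aij].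
    by have := u0 (i, j); rewrite !inE /= Aij /= => /negbFE /andP[].
  apply/forallP=> i; apply/implyP => /existsP[j Aij].
  by have := u0 (i, j); rewrite !inE /= Aij /= => /negbFE /andP[].
have U_ge u : u \in U -> (#|C| <= #|clashing A u|)%N.
  case/inX=> _ /set1P u2; rewrite -[#|C|]mul1n -(cards1 k0) -cardsX.
  apply/subset_leq_card/subsetP => v /inX[/set1P v1 v2].
  by rewrite !inE v1 u2 (CP _ _ _ v2 Arow) (negPf A0) andbF.
have V_ge v : v \in V -> (#|F| <= #|clashing A v|)%N.
  case/inX=> /set1P v1 _; rewrite -[#|F|]muln1 -(cards1 j0) -cardsX.
  apply/subset_leq_card/subsetP => u /inX[u1 /set1P u2].
  by rewrite !inE v1 u2 (FP _ _ _ u1 Acol) (negPf A0).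
have k0F : k0 \in F = false by apply: contraNF A0 => /FP/(_ Acol).
have j0C : j0 \in C = false by apply: contraNF A0 => /CP/(_ Arow).
have sI : I \subset ones A.
  apply/subsetP => u /inX[u1 u2].
  by rewrite inE (FP _ _ _ u1 (CP _ _ _ u2 Arow)).
have sU : U \subset ones A :\: I.
  apply/subsetP => u /inX[u1 /set1P u2].
  by rewrite in_setD inXE u2 j0C andbF inE u2 (FP _ _ _ u1 Acol).
have sV : V \subset ones A :\: I :\: U.
  apply/subsetP => v /inX[/set1P v1 v2].
  by rewrite !in_setD !inXE v1 k0F /= inE v1 (CP _ _ _ v2 Arow).
rewrite (big_setID I) /= (setIidPr sI).
rewrite [X in (_ + X)%N](big_setID U) /= (setIidPr sU).
rewrite [X in (_ + (_ + X))%N](big_setID V) /= (setIidPr sV).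
set W := _ :\: V.
have sumU : (#|F| * #|C| <= \sum_(u in U) #|clashing A u|)%N.
  by rewrite -[#|F|]muln1 -(cards1 j0) -cardsX -sum_nat_const leq_sum.
have sumU1 : (#|F| <= \sum_(u in U) #|clashing A u|)%N.
  rewrite -[#|F|]muln1 -(cards1 j0) -cardsX -sum1_card leq_sum // => u Uu.
  by have := subsetP sU u Uu; rewrite in_setD => /andP[uI Au]; apply: W_ge.
have sumV : (#|C| * #|F| <= \sum_(u in V) #|clashing A u|)%N.
  by rewrite -[#|C|]mul1n -(cards1 k0) -cardsX -sum_nat_const leq_sum.
have sumV1 : (#|C| <= \sum_(u in V) #|clashing A u|)%N.
  rewrite -[#|C|]mul1n -(cards1 k0) -cardsX -sum1_card leq_sum // => u Vu.
  by have := subsetP sV u Vu; rewrite !in_setD => /and3P[_ uI Au]; apply: W_ge.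
have sumW : (#|W| <= \sum_(u in W) #|clashing A u|)%N.
  rewrite -sum1_card leq_sum // => u; rewrite !in_setD => /and4P[_ _ uI Au].
  exact: W_ge.
have cardO : #|ones A| = (#|F| * #|C| + (#|F| + (#|C| + #|W|)))%N.
  rewrite -(cardsID I (ones A)) (setIidPr sI).
  rewrite -(cardsID U (_ :\: _)) (setIidPr sU).
  by rewrite -(cardsID V (_ :\: U)) (setIidPr sV) !cardsX !cards1 muln1 mul1n.
have bound r c w i u v x : (r * c <= u -> r <= u -> c * r <= v -> c <= v ->
    w <= x -> (r * c + (r + (c + w))).-1 <= i + (u + (v + x)))%N.
  by case: r => [|r]; case: c => [|c]; nia.
by rewrite cardO; apply: bound.
Qed.

(** If every position in a nonzero row and a nonzero column held a one, the ones
    would form a rectangle with sides at most n < m, impossible for a prime. *)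
Lemma sum_clashing_ge_prime (n m : nat) (A : 'M[bool]_n) :
  A \in Z01 n m -> (n < m)%N -> prime m ->
  (m.-1 <= \sum_(u in ones A) #|clashing A u|)%N.
Proof.
rewrite inE => /eqP cardA lt_nm pr_m; rewrite -cardA -/(ones A).
pose P := [set i | [exists j, A i j]]; pose Q := [set j | [exists i, A i j]].
have [/existsP[k0 /existsP[j0]]|] :=
  boolP [exists k, exists j, [&& k \in P, j \in Q & ~~ A k j]].
  rewrite !inE => /and3P[/existsP[l1 Arow] /existsP[i1 Acol] A0].
  exact: sum_clashing_ge A0 Arow Acol.
rewrite negb_exists => /forallP full; exfalso.
have onesE : ones A = setX P Q.
  apply/setP => -[i j]; rewrite in_setX inE /=.
  apply/idP/andP => [Aij | [Pi Qj]].
    by rewrite !inE; split; apply/existsP; [exists j | exists i].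
  have := full i; rewrite negb_exists => /forallP/(_ j).
  by rewrite Pi Qj negbK.
have mE : m = (#|P| * #|Q|)%N by rewrite -cardA -/(ones A) onesE cardsX.
have lePn : (#|P| <= n)%N by rewrite -[n in (_ <= n)%N]card_ord max_card.
have leQn : (#|Q| <= n)%N by rewrite -[n in (_ <= n)%N]card_ord max_card.
have /(primeP pr_m).2 : (#|P| %| m)%N by rewrite mE dvdn_mulr.
have m_gt0 := prime_gt0 pr_m.
case/pred2P => [P1 | Pm]; last by rewrite Pm leqNgt lt_nm in lePn.
by move: leQn; rewrite -[#|Q|]mul1n -P1 -mE leqNgt lt_nm.
Qed.

(** * Trace norms of (0,1)-matrices *)

Lemma trace_norm_ge (R : rcfType) (n m b : nat) (A : 'M[bool]_n) :
    A \in Z01 n m -> (b <= \sum_(u in ones A) #|clashing A u|)%N ->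
  Num.sqrt (m%:R + Num.sqrt (2 * b%:R)) <= trace_norm (mx01 R A).
Proof.
rewrite inE => /eqP cardA le_b.
have [s_ge0 sum2 sum4 _] := singular_valuesP (mx01 R A).
rewrite trace_sqr_gram_mx01 /ones cardA -/(ones A) in sum4.
rewrite trace_gram_mx01 /ones cardA in sum2.
have [] := sum_power_bounds s_ge0; rewrite sum2 sum4 -/(trace_norm _).
set t := trace_norm _; set c := \sum_(u in _) _ => t_ge0 le_mt le_t.
have le_bc : b%:R <= c%:R :> R by rewrite ler_nat.
rewrite -[t]ger0_norm // -sqrtr_sqr ler_wsqrtr // -lerBrDl.
rewrite -[leRHS]ger0_norm ?subr_ge0 // -sqrtr_sqr ler_wsqrtr //.
by apply: le_trans le_t; rewrite ler_pM2l ?ltr0n //; lra.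
Qed.

Lemma trace_norm_eq (R : rcfType) (n m b : nat) (A : 'M[bool]_n) :
    A \in Z01 n m -> \sum_(u in ones A) #|clashing A u| = b ->
    (\rank (mx01 R A) <= 2)%N ->
  trace_norm (mx01 R A) = Num.sqrt (m%:R + Num.sqrt (2 * b%:R)).
Proof.
rewrite inE => /eqP cardA def_b rkA.
have [s_ge0 sum2 sum4 rks] := singular_valuesP (mx01 R A).
rewrite trace_sqr_gram_mx01 /ones cardA -/(ones A) def_b in sum4.
rewrite trace_gram_mx01 /ones cardA in sum2.
have [] := sum_power_bounds s_ge0.
have := sum_power_two (leq_trans rks rkA).
rewrite sum2 sum4 -/(trace_norm _).
set t := trace_norm _ => eq_t t_ge0 le_mt _.
rewrite (_ : 2 * b%:R = (t ^+ 2 - m%:R) ^+ 2); last by rewrite eq_t; ring.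
by rewrite sqrtr_sqr ger0_norm ?subr_ge0 // addrC subrK sqrtr_sqr ger0_norm.
Qed.

(** * Extremal matrices *)

Lemma card_ord_lt (n c : nat) : (c <= n)%N -> #|[set i : 'I_n | (i < c)%N]| = c.
Proof.
by move=> le_cn; rewrite -sum1dep_card (big_ord_narrow le_cn) sum1_card card_ord.
Qed.

Lemma trace_norm_block (R : rcfType) (n a b : nat) : (a <= n)%N -> (b <= n)%N ->
  exists2 A : 'M[bool]_n, A \in Z01 n (a * b) &
    trace_norm (mx01 R A) = Num.sqrt (a * b)%:R.
Proof.
move=> le_an le_bn; pose A : 'M[bool]_n := \matrix_(i, j) ((i < a) && (j < b))%N.
have ZA : A \in Z01 n (a * b).
  rewrite inE -[X in _ == (X * _)%N](card_ord_lt le_an).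
  rewrite -[X in _ == (_ * X)%N](card_ord_lt le_bn).
  by rewrite -cardsX; apply/eqP/eq_card => -[i j]; rewrite !inE mxE.
exists A => //; rewrite (trace_norm_eq (b := 0) ZA) ?mulr0 ?sqrtr0 ?addr0 //.
  rewrite big1 // => u; rewrite inE mxE => /andP[u1 u2]; apply/eqP.
  rewrite cards_eq0; apply/eqP/setP => v; rewrite !inE !mxE u1 u2 /= andbT.
  by case: (v.1 < a)%N; case: (v.2 < b)%N.
have -> : mx01 R A = (\col_i (i < a)%N%:R) *m (\row_j (j < b)%N%:R).
  by apply/matrixP => i j; rewrite !mxE big_ord1 !mxE -natrM mulnb.
by apply: leq_trans (mulmx_max_rank _ _) _.
Qed.

(** The first column has k ones on top and the second one misses the topmost of
    them.  The one in the corner (j0, j0) clashes with the k - 1 ones of the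
    second column, and there is no other clash. *)
Lemma trace_norm_two_columns (R : rcfType) (n k : nat) :
    (2 <= n)%N -> (0 < k <= n)%N ->
  exists2 A : 'M[bool]_n, A \in Z01 n k.*2.-1 &
    trace_norm (mx01 R A) =
    Num.sqrt (k.*2.-1%:R + Num.sqrt (2 * (k.-1.*2)%:R)).
Proof.
move=> n_ge2 /andP[k_gt0 le_kn].
(* j0 is the index 0, for rows as well as for columns. *)
have [j0 [j1 [j0E j10]]] : exists j0 j1 : 'I_n, j0 = 0%N :> nat /\ j1 != j0.
  by exists (Ordinal (ltnW n_ge2)), (Ordinal n_ge2).
pose A : 'M[bool]_n :=
  \matrix_(i, j) ((i < k)%N && ((j == j0) || (j == j1) && (i != j0))).
pose B := [set i : 'I_n | (i < k)%N].
have cardB : #|B| = k := card_ord_lt le_kn.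
have B0 : j0 \in B by rewrite inE j0E.
have cardB' : #|B :\ j0| = k.-1.
  by rewrite (cardsD1 j0) B0 in cardB; rewrite -cardB.
pose V := setX (B :\ j0) [set j1]; pose U := setX B [set j0].
have UV : [disjoint U & V].
  rewrite -setI_eq0; apply/eqP/setP=> -[i j].
  rewrite in_setI !in_setX !in_set1 in_set0.
  by case: (eqVneq j j0) => [->|_]; rewrite ?andbF // eq_sym (negPf j10) !andbF.
have onesE : ones A = U :|: V.
  apply/setP => -[i j].
  rewrite in_setU !in_setX !inE mxE /=.
  by case: (i < k)%N; case: (i == j0); case: (j == j0); case: (j == j1).
have ZA : A \in Z01 n k.*2.-1.
  rewrite inE -/(ones A) onesE cardsU disjoint_setI0 // cards0 subn0.
  by rewrite !cardsX !cards1 cardB cardB' !muln1; apply/eqP; lia.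
exists A => //; apply: trace_norm_eq ZA _ _.
  have clash00 : clashing A (j0, j0) = V.
    apply/setP => -[i j]; rewrite in_setX !inE !mxE /= !eqxx j0E k_gt0 /=.
    case: (eqVneq j j0) => [->|_]; rewrite ?[j0 == _]eq_sym ?(negPf j10);
      by case: (i < k)%N; case: (i == j0); case: (j == j1).
  have clashE u : u \in ones A :\ (j0, j0) ->
      #|clashing A u| = if u \in V then 1%N else 0%N.
    case: u => i j; rewrite in_setD1 xpair_eqE negb_and [_ \in ones A]inE mxE /=.
    rewrite [(i, j) \in V]in_setX !inE /= => /andP[ij00 /andP[ik]].
    have [j_j0 _|_ /= /andP[/eqP -> i0]] := eqVneq j j0.
      rewrite j_j0 [j0 == j1]eq_sym (negPf j10) andbF; apply/eqP.
      rewrite cards_eq0; apply/eqP/setP => -[i' j']; rewrite !inE !mxE ik /=.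
      rewrite j_j0 eqxx orbF in ij00; rewrite ij00 andbT eqxx.
      by case: (i' < k)%N; case: (j' == j0); case: (j' == j1); case: (i' == j0).
    rewrite i0 ik eqxx; apply/eqP/cards1P; exists (j0, j0).
    apply/setP => -[i' j']; rewrite !inE !mxE xpair_eqE ik /=.
    rewrite i0 eqxx (negPf j10) andbT /=.
    case: (eqVneq i' j0) => [->|_].
      by rewrite j0E k_gt0 /= !(andbF, orbF, andbT).
    by case: (i' < k)%N; case: (j' == j0); case: (j' == j1).
  rewrite (big_setD1 (j0, j0)) /=; last first.
    by rewrite onesE inE in_setX B0 in_set1 eqxx.
  rewrite (eq_bigr _ clashE) -big_mkcondr /= sum1dep_card clash00.
  have -> : [set u in ones A :\ (j0, j0) | u \in V] = V.
    apply/setP => u; rewrite inE; case Vu: (u \in V); last by rewrite andbF.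
    rewrite andbT in_setD1 onesE in_setU Vu orbT andbT.
    by apply: contraTneq Vu => ->; rewrite in_setX in_setD1 eqxx.
  by rewrite cardsX cards1 cardB' muln1 -addnn.
pose e (t : 'I_2) : 'I_n := if t == 0%R then j0 else j1.
have -> : mx01 R A = colsub e (mx01 R A) *m rowsub e 1%:M.
  apply/matrixP => i j; rewrite mxE [in RHS]mxE big_ord_recl big_ord1 !mxE /e /=.
  case: (eqVneq j j0) => [->|j_j0]; rewrite ?eqxx ?(negPf j10).
    by rewrite mulr1 mulr0 addr0.
  rewrite mulr0 add0r; case: (eqVneq j j1) => [_|_]; rewrite ?mulr1 //.
  by rewrite andbF mulr0.
exact: mulmx_max_rank.
Qed.

Theorem theorem2 (R : rcfType) (n m : nat)
  (hn : (2 <= n)%N) (hm : (n < m <= 2 * n)%N) :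
  (prime m -> psi R n m = Num.sqrt (m%:R + Num.sqrt (2 * (m%:R - 1)))) /\
  (~~ prime m -> psi R n m = Num.sqrt m%:R).
Proof.
case/andP: hm => lt_nm le_m2n.
have le_mn2 : (m <= n ^ 2)%N.
  by rewrite (leq_trans le_m2n) // -mulnn leq_mul2r hn orbT.
have m_gt0 : (0 < m)%N by apply: leq_ltn_trans lt_nm.
have [A ZA psiE] := psi_attained R le_mn2.
split=> [pr_m | npr_m]; apply/le_anti/andP; split.
- have odd_m : odd m by case: (even_prime pr_m) => // m2; lia.
  (* k = (m + 1) / 2 *)
  have defm : m = (m./2.+1).*2.-1 by lia.
  have [|B ZB trB] := @trace_norm_two_columns R n m./2.+1 hn; first by lia.
  have -> : m%:R - 1 = (m./2.*2)%:R :> R.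
    by rewrite -[1]/(1%:R) -natrB //; congr (1 *+ _); lia.
  by rewrite -defm in ZB trB; rewrite -trB psi_le.
- have -> : m%:R - 1 = m.-1%:R :> R by rewrite -subn1 natrB.
  by rewrite psiE trace_norm_ge // sum_clashing_ge_prime.
- have m_gt1 : (1 < m)%N by apply: leq_ltn_trans lt_nm; apply: ltnW.
  case/primePn: npr_m => [|[a /andP[a_gt1 lt_am] /dvdnP[b def_m]]]; first lia.
  have b_gt1 : (1 < b)%N by case: b def_m => [|[|b]] //; lia.
  have le_bn : (2 * b <= m)%N by rewrite def_m mulnC leq_mul2l a_gt1 orbT.
  have le_an : (2 * a <= m)%N by rewrite def_m leq_mul2r b_gt1 orbT.
  have [| | B ZB trB] := @trace_norm_block R n b a; [lia | lia |].
  by rewrite -def_m in ZB trB; rewrite -trB psi_le.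
- by have := trace_norm_ge R ZA (leq0n _); rewrite mulr0 sqrtr0 addr0 psiE.
Qed.
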